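(* Let $\varphi:[0,\pi]\to\mathbb{R}_+$ be twice continuously differentiable and increasing on $[0,\pi]$, with $\varphi'>0$ on $(0,\pi)$, and such that $0$ is an entrance boundary for the diffusion $$dX(t)=\sqrt{2}\,dB(t)+\frac{1}{\varphi'(X(t))}\,dt .$$ Start this diffusion at $X(0)=0$ and let $\tau$ be its hitting time of $\pi$. Assume that $\min_{[0,\pi]}\varphi''>-1$. Then $$\mathbb{E}[\tau]\le\frac{\varphi(\pi)-\varphi(0)}{1+\min_{[0,\pi]}\varphi''}.$$
   Context: $(B(t))_{t\ge 0}$ is a standard real Brownian motion. The diffusion is defined up to the time $\tau$. ''Entrance boundary'' means that the diffusion can be started at $0$ and never returns to $0$ at positive times. *)

(* Defs.v *)
From HB Require Import structures.
From mathcomp Require Import all_boot all_order all_algebra.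
From mathcomp Require Import all_classical all_reals all_analysis.
Set Implicit Arguments.
Unset Strict Implicit.
Unset Printing Implicit Defensive.
Import Order.TTheory GRing.Theory Num.Theory.
Import numFieldNormedType.Exports.
Local Open Scope classical_set_scope.
Local Open Scope ring_scope.

Section derivative_within.
Context {R : realType}.

Definition diff_quotient (f : R -> R) (x y : R) : R := (f y - f x) / (y - x).

(* Derivatives of [f] relative to [A]: for [A] a segment these are the usual
   derivatives in the interior and the one-sided ones at the end points. The
   values of [f] outside [A] play no role. *)
Definition derivable_within (A : set R) (f : R -> R) (x : R) : Prop :=
  cvg (diff_quotient f x @ within A x^').

Definition derive_within (A : set R) (f : R -> R) (x : R) : R :=
  lim (diff_quotient f x @ within A x^').

Definition C2_on (A : set R) (f : R -> R) : Prop :=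
  [/\ forall x, A x -> derivable_within A f x,
      forall x, A x -> derivable_within A (derive_within A f) x
    & {within A, continuous (derive_within A (derive_within A f))}].

Definition is_min (A : set R) (m : R) : Prop := A m /\ lbound A m.

End derivative_within.

Section processes.
Context {R : realType} {d : measure_display} {Omega : measurableType d}.
Variable P : probability Omega R.

(* Processes and filtrations are indexed by [R]; only the times [t >= 0]
   matter. *)
Definition is_filtration (F : R -> set (set Omega)) : Prop :=
  [/\ forall t, 0 <= t -> sigma_algebra setT (F t),
      forall t, 0 <= t -> F t `<=` measurable
    & forall s t : R, 0 <= s -> s <= t -> F s `<=` F t].

Definition adapted (F : R -> set (set Omega)) (X : R -> Omega -> R) : Prop :=
  forall t, 0 <= t -> forall D : set R, measurable D -> F t (X t @^-1` D).

Definition continuous_paths (X : R -> Omega -> R) : Prop :=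
  forall w, {within `[0, +oo[, continuous (X ^~ w)}.

(* Standard real Brownian motion relative to the filtration [F]; the second
   parameter of [normal_prob] is the standard deviation. *)
Record brownian_motion (F : R -> set (set Omega)) (B : R -> Omega -> R)
    : Prop := {
  bm_adapted : adapted F B ;
  bm_continuous : continuous_paths B ;
  bm_start : {ae P, forall w, B 0 w = 0} ;
  bm_gaussian : forall s t : R, 0 <= s -> s < t ->
    forall D : set R, measurable D ->
    P [set w | D (B t w - B s w)%R] = normal_prob 0 (Num.sqrt (t - s)) D ;
  bm_indep : forall s t : R, 0 <= s -> s < t ->
    forall (A : set Omega) (D : set R), F s A -> measurable D ->
    P (A `&` [set w | D (B t w - B s w)%R]) =
    (P A * P [set w | D (B t w - B s w)%R])%E }.

(* [+oo] if [a] is never hit. *)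
Definition hitting_time (X : R -> Omega -> R) (a : R) (w : Omega) : \bar R :=
  ereal_inf [set t%:E | t in [set t : R | 0 <= t /\ X t w = a]].

(* (Weak) solution of dX = sqrt 2 dB + dt / phi'(X), with values in [0, pi],
   started at [x0] and considered up to its hitting time of [pi]: the noise
   being additive, the equation is a pathwise integral equation. The path of
   [X] after the hitting time is any continuous adapted continuation (e.g. the
   constant [pi]) and is unconstrained.
   The drift is read as [0] where phi' = 0 (inverse of [0]); this is
   immaterial, since phi' > 0 on the open interval and a semimartingale with
   bracket 2t spends Lebesgue-null time at [0] and at [pi]. The drift integral
   is extended-real valued, so its finiteness is part of [dif_sde]. *)
Record diffusion (phi : R -> R) (x0 : R) (F : R -> set (set Omega))
    (B X : R -> Omega -> R) : Prop := {
  dif_filtration : is_filtration F ;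
  dif_brownian : brownian_motion F B ;
  dif_adapted : adapted F X ;
  dif_continuous : continuous_paths X ;
  dif_start : {ae P, forall w, X 0 w = x0} ;
  dif_range : {ae P, forall w, forall t : R, 0 <= t ->
    (t%:E <= hitting_time X pi w)%E -> 0 <= X t w <= pi} ;
  dif_sde : {ae P, forall w, forall t : R, 0 <= t ->
    (t%:E <= hitting_time X pi w)%E ->
    (X t w)%:E = ((X 0%R w + Num.sqrt 2 * B t w)%:E +
      \int[lebesgue_measure]_(s in `[0%R, t])
         ((derive_within `[0%R, pi] phi (X s w))^-1)%:E)%E} }.

End processes.

(* The diffusion can be started at 0, and then never returns to 0 at positive
   times (of its lifetime, which ends when [pi] is hit). *)
Definition entrance_boundary_at_0 (R : realType) (phi : R -> R) : Prop :=
  (exists (d : measure_display) (Omega : measurableType d)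
     (P : probability Omega R) (F : R -> set (set Omega))
     (B X : R -> Omega -> R), diffusion P phi 0 F B X) /\
  (forall (d : measure_display) (Omega : measurableType d)
     (P : probability Omega R) (F : R -> set (set Omega))
     (B X : R -> Omega -> R), diffusion P phi 0 F B X ->
     {ae P, forall w, forall t : R, 0 < t ->
       (t%:E <= hitting_time X pi w)%E -> X t w <> 0}).

(* Main.v *)
Require Import Defs.
From HB Require Import structures.
From mathcomp Require Import all_boot all_order all_algebra.
From mathcomp Require Import all_classical all_reals all_analysis.
From mathcomp Require Import measurable_realfun ring lra.
Set Implicit Arguments.
Unset Strict Implicit.
Unset Printing Implicit Defensive.
Import Order.TTheory GRing.Theory Num.Theory.
Import numFieldNormedType.Exports.
Local Open Scope classical_set_scope.
Local Open Scope ring_scope.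

(** The time spent by the diffusion before it hits [pi] is measured on a grid of
    step [h], without stochastic integrals or continuous stopping times.

    Write [g] for the derivative of [phi], and let [0 < b < a < pi]. From time
    [t0 > 0] on, a path is called good as long as, at the times of the grid, it lies
    in [[b, a]] and its successive increments are at least
    [sqrt 2 * (B t' - B t) + h * (1 - e) / g (X t)]. These are finitely many
    conditions, adapted to the filtration. On a good event known at time [t], the
    increment of [B] is independent of the past and centred Gaussian of variance
    [h]. Monotonicity of [phi] and the Taylor bound
    [phi y >= phi x + g x * (y - x) + m / 2 * (y - x) ^ 2] ([taylor2_ge]) then give,
    for [h] small, a mean increase of [phi] of at least [h * (1 + m - 2 * e)]: the
    drift contributes [g * (1 - e) / g] and the Gaussian variance contributes [m]
    ([normal_taylor_ge], [one_step_ge]). A path that stops being good is credited with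
    the maximal value [phi pi], whatever it does afterwards, so the increases
    telescope and the mean time spent good is at most
    [(phi pi - phi 0) / (1 + m - 2 * e)] ([sum_good_le]).

    Conversely, before it hits [pi] the path is in the open interval [(0, pi)] at
    positive times, because [0] is an entrance boundary. There [1 / g (X s)] is
    continuous and positive, so by uniform continuity the integral equation makes
    the path good between [t0] and any time before the hitting time, once [h] is
    small and [[b, a]] is large ([good_of_path]). Fatou's lemma along a sequence of
    such grids bounds the mean hitting time by
    [t0 + (phi pi - phi 0) / (1 + m - 2 * e)] ([mean_hitting_time_le]); finally [t0]
    and [e] tend to [0].

    The Gaussian means are computed from the moment generating function only: the
    function to be integrated is first bounded below by a combination of
    exponentials ([expo_minorant]). *)

(** * Derivatives relative to a segment, Taylor minoration, uniform continuity *)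

Lemma within_itv_dnbhs (R : realType) (u v x : R) :
  u < x < v -> within `[u, v]%classic x^' = x^'.
Proof.
move=> /andP[ux xv].
have xuv : nbhs x `[u, v]%classic.
  have /near_in_itvoo : x \in `]u, v[ by rewrite in_itv/= ux.
  by apply: filterS => y /=; rewrite !in_itv/= => /andP[/ltW -> /ltW ->].
apply/seteqP; split => B.
  move=> H; change (nbhs x (fun y => y != x -> B y)).
  have {H} : nbhs x (fun y => y != x -> `[u, v]%classic y -> B y) by [].
  by apply: filterS2 xuv => y uvy By yx; exact: By.
change (nbhs x (fun y => y != x -> B y) ->
  nbhs x (fun y => y != x -> `[u, v]%classic y -> B y)).
by apply: filterS => y By yx _; exact: By.
Qed.

(** At interior points the derivative relative to a segment is the usual one. *)
Lemma is_derive_within (R : realType) (u v x : R) (f : R -> R) :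
  u < x < v -> derivable_within `[u, v] f x ->
  is_derive x 1 f (derive_within `[u, v] f x).
Proof.
move=> /within_itv_dnbhs E; rewrite /derivable_within/derive_within E => dfx.
apply/is_derive1_caratheodory.
set l := lim _.
pose q y := if y == x then l else diff_quotient f x y.
have qx : q x = l by rewrite /q eqxx.
exists q; split => //.
  move=> z; rewrite /q; case: eqP => [->|/eqP zx]; first by rewrite !subrr mulr0.
  by rewrite /diff_quotient divfK// subr_eq0.
apply/continuous_withinNx; rewrite qx.
apply: cvg_trans dfx; apply: near_eq_cvg.
by near=> y; rewrite /q ifF//; apply/negbTE; near: y; exact: nbhs_dnbhs_neq.
Unshelve. all: by end_near. Qed.

Lemma is_derive_continuous (R : realType) (f : R -> R) (x l : R) :
  is_derive x 1 f l -> {for x, continuous f}.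
Proof. by move=> [df _]; apply/differentiable_continuous/derivable1_diffP. Qed.

(** The mean value theorem without any order between the two points. *)
Lemma mean_value (R : realType) (f df : R -> R) (u v x y : R) :
  (forall z, u < z < v -> is_derive z 1 f (df z)) ->
  u < x < v -> u < y < v ->
  exists2 c, Num.min x y <= c <= Num.max x y & f y - f x = df c * (y - x).
Proof.
move=> dfz.
suff H a b : u < a < v -> u < b < v -> a <= b ->
    exists2 c, a <= c <= b & f b - f a = df c * (b - a).
  move=> xuv yuv; have [xy|yx] := leP x y; first exact: H.
  have [c cab E] := H _ _ yuv xuv (ltW yx).
  by exists c => //; rewrite -opprB E -mulrN opprB.
move=> /andP[ua av] /andP[ub bv] ab.
have [|||c] := @MVT_segment R f df a b => //.
- move=> z /[!in_itv]/= /andP[az zb]; apply: dfz.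
  by rewrite (lt_trans ua az)/= (lt_trans zb bv).
- apply: derivable_within_continuous => z /[!in_itv]/= /andP[az zb].
  have /dfz[] // : u < z < v.
  by rewrite (lt_le_trans ua az)/= (le_lt_trans zb bv).
- by rewrite in_itv/= => acb E; exists c.
Qed.

(** Only a lower bound on the second derivative is needed: its continuity plays
    no role, since the mean value theorem is applied to [f] and then to [df]. *)
Lemma taylor2_ge (R : realType) (f df ddf : R -> R) (u v m : R) :
  (forall z, u < z < v -> is_derive z 1 f (df z)) ->
  (forall z, u < z < v -> is_derive z 1 df (ddf z)) ->
  (forall z, u < z < v -> m <= ddf z) ->
  forall x y, u < x < v -> u < y < v ->
  f x + df x * (y - x) + m / 2 * (y - x) ^+ 2 <= f y.
Proof.
move=> f1 f2 mf x y xuv yuv.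
pose h z := f z - df x * z - m / 2 * (z - x) ^+ 2.
pose dh z := df z - df x - m * (z - x).
have hd z : u < z < v -> is_derive z 1 h (dh z).
  move=> /f1 dz; rewrite /h /dh.
  have -> : (fun z => f z - df x * z - m / 2 * (z - x) ^+ 2) =
     f - (df x \*: id) - ((m / 2) \*: ((id - cst x) ^+ 2)).
    by apply/funext => w /=; rewrite !fctE.
  apply: is_derive_eq; rewrite !fctE/= /GRing.scale/= subr0 !mulr1 expr1.
  by field.
have between c : Num.min x y <= c <= Num.max x y -> u < c < v.
  move: xuv yuv => /andP[ux xv] /andP[uy yv] /andP[xyc cxy].
  by rewrite (lt_le_trans _ xyc) ?lt_min ?ux// (le_lt_trans cxy)// gt_max xv.
have [c cxy E] := mean_value hd xuv yuv.
have [e exc Ee] := mean_value f2 xuv (between _ cxy).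
have euv : u < e < v.
  apply: between; move: exc cxy.
  by have [|] := leP x y; have [|] := leP x c; lra.
have : 0 <= dh c * (y - x).
  rewrite /dh Ee -mulrBl -mulrA mulr_ge0//; first by rewrite subr_ge0 mf.
  move: cxy; have [xy|xy] := leP x y => /andP[xc cy].
    by rewrite mulr_ge0// subr_ge0.
  by rewrite mulr_le0// subr_le0// ltW.
by rewrite -E /h subrr expr0n/= mulr0; lra.
Qed.

(** Heine; continuity is two-sided at the points of [K], so that one of the two
    points may leave [K]. *)
Lemma compact_unif_continuous (R : realType) (f : R -> R) (K : set R) :
  compact K -> (forall x, K x -> {for x, continuous f}) ->
  forall e, 0 < e -> exists2 d, 0 < d &
  forall x y, K x -> `|y - x| < d -> `|f y - f x| < e.
Proof.
move=> /compact_near_coveringP cK cf e e0.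
pose Q (d x : R) := forall y, `|y - x| < d -> `|f y - f x| < e.
have H : \forall d \near 0^'+, K `<=` Q d.
  apply: cK.
  move=> x /cf /cvgrPdist_lt /(_ (e / 2)).
  rewrite divr_gt0// => /(_ isT); rewrite near_nbhs_norm => -[d /= d0 fxd].
  near=> x' h => y yx'.
  have h2 : h < d / 2 by near: h; apply: nbhs_right_lt; rewrite divr_gt0.
  have xx' : `|x - x'| < d / 2.
    by near: x'; apply/nbhs_normP; exists (d / 2) => //=; rewrite divr_gt0.
  have xyd : `|x - y| < d.
    rewrite (splitr d) (le_lt_trans (ler_distD x' x y))// ltrD//.
    by rewrite distrC (lt_trans yx').
  have A1 := fxd y xyd.
  have A2 : `|f x - f x'| < e / 2.
    by apply: fxd; rewrite /= (lt_trans xx')// gtr_pMr// invf_lt1// ltr1n.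
  by rewrite (splitr e) (le_lt_trans (ler_distD (f x) (f y) (f x')))// ltrD// distrC.
have d0 : \forall d \near (0 : R)^'+, 0 < d by exact: nbhs_right_gt.
have [d [dpos Kd]] := filter_ex (filterI d0 H).
by exists d => // x y Kx; exact: Kd.
Unshelve. all: by end_near. Qed.

(** * An exponential minorant for functions with a quadratic lower bound *)

Lemma expR_le_quad (R : realType) (y : R) :
  y <= 1 / 2 -> expR y <= 1 + y + 2 * y ^+ 2.
Proof.
move=> y2; have y1 : 0 < 1 - y by lra.
have -> : expR y = (expR (- y))^-1 by rewrite expRN invrK.
apply: (@le_trans _ _ (1 - y)^-1).
  by rewrite lef_pV2 ?posrE ?expR_gt0//; have := expR_ge1Dx (- y); lra.
rewrite -[leLHS]mul1r ler_pdivrMr//.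
by have := sqr_ge0 y; nra.
Qed.

Lemma expR_taylor2 (R : realType) (w : R) : `|w| <= 1 / 2 ->
  `|expR w - 1 - w - w ^+ 2 / 2| <= 2 * `|w| ^+ 3.
Proof.
move=> w2.
pose f (z : R) : R := expR z - z - 2^-1 * z ^+ 2.
pose df (z : R) : R := expR z - 1 - z.
have fd (z : R) : -1 < z < 1 -> is_derive z 1 f (df z).
  move=> _; rewrite /f /df.
  have -> : (fun z : R => expR z - z - 2^-1 * z ^+ 2) =
     expR - id - (2^-1 \*: (id ^+ 2)).
    by apply/funext => x /=; rewrite !fctE.
  apply: is_derive_eq; rewrite /GRing.scale/= !mulr1 expr1.
  by field.
have [||c cw E] := @mean_value R f df (-1) 1 0 w fd.
- by rewrite ltrN10 ltr01.
- by rewrite -ltr_norml (le_lt_trans w2)//; lra.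
have cw' : `|c| <= `|w|.
  by move: cw; have [w0|w0] := leP 0 w;
    [rewrite (ger0_norm w0)|rewrite (ltr0_norm w0)] => /andP[? ?];
    rewrite ler_norml; apply/andP; split; lra.
have dfc : `|df c| <= 2 * `|c| ^+ 2.
  rewrite ger0_norm; last by rewrite /df; have := expR_ge1Dx c; lra.
  have : c <= 1/2 by rewrite (le_trans (ler_norm c))// (le_trans cw').
  by move=> /expR_le_quad; rewrite /df real_normK ?num_real//; lra.
have -> : expR w - 1 - w - w ^+ 2 / 2 = df c * w.
  have <- : w - 0 = w by rewrite subr0.
  by rewrite -E /f expR0 expr0n/= mulr0 !subr0; lra.
rewrite normrM exprSr mulrA ler_wpM2r// (le_trans dfc)// ler_pM2l//.
by rewrite lerXn2r ?nnegrE.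
Qed.

(** A combination of [expR (k * w)], [k] in {-2, -1, 0, 1, 2}, which behaves like
    [p * w + m / 2 * w ^+ 2] near [0] and is very negative far from [0] when [K]
    is large. Unlike those of the parabola, its Gaussian means follow from the
    moment generating function alone. *)
Definition expo_test (R : realType) (m p K w : R) : R :=
  (m + p) / 2 * (expR w - 1) + (m - p) / 2 * (expR (- w) - 1) -
  K * (expR w + expR (- w) - 2) ^+ 2.

Lemma cosh_ge (R : realType) (w : R) :
  w ^+ 2 / 4 <= expR w + expR (- w) - 2.
Proof.
wlog w0 : w / 0 <= w.
  move=> H; have [/H//|w0] := leP 0 w.
  by have := H (- w); rewrite opprK sqrrN => /(_ _); lra.
have -> : expR w + expR (- w) - 2 = (expR (w / 2) - expR (- (w / 2))) ^+ 2.
  have e1 : expR w = expR (w / 2) * expR (w / 2).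
    by rewrite -expRD; congr expR; field.
  have e2 : expR (- w) = expR (- (w / 2)) * expR (- (w / 2)).
    by rewrite -expRD; congr expR; field.
  have := expRxMexpNx_1 (w / 2).
  by rewrite e1 e2 => e3; ring: e3.
have w20 : 0 <= w / 2 by rewrite divr_ge0.
have : w / 2 <= expR (w / 2) - expR (- (w / 2)).
  have := expR_ge1Dx (w / 2).
  have : expR (- (w / 2)) <= 1 by rewrite -[leRHS]expR0 ler_expR oppr_le0.
  by lra.
have -> : w ^+ 2 / 4 = (w / 2) ^+ 2 by field.
by move=> H; rewrite lerXn2r// nnegrE// (le_trans w20).
Qed.

Lemma expo_test_le_parabola (R : realType) (m p K w e A : R) :
  0 <= K -> `|m| + `|p| <= A -> `|w| <= 1 / 2 -> 4 * A * `|w| <= e ->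
  expo_test m p K w <= p * w + (m + e) / 2 * w ^+ 2.
Proof.
move=> K0 mpA w2 we; rewrite /expo_test.
set a := (m + p) / 2; set b := (m - p) / 2.
have abA : `|a| + `|b| <= A.
  rewrite /a /b !normrM !(@ger0_norm _ 2^-1) ?invr_ge0//.
  by move: (ler_normD m p) (ler_normB m p); lra.
have H1 := expR_taylor2 w2.
have H2 : `|expR (- w) - 1 + w - w ^+ 2 / 2| <= 2 * `|w| ^+ 3.
  by have := @expR_taylor2 R (- w); rewrite normrN sqrrN opprK; apply.
have cubic (c x y : R) : `|x - y| <= 2 * `|w| ^+ 3 ->
    c * x <= c * y + `|c| * (2 * `|w| ^+ 3).
  move=> H; rewrite -lerBlDl -mulrBr (le_trans (ler_norm _))// normrM.
  by rewrite ler_wpM2l.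
have G1 := cubic a (expR w - 1) (w + w ^+ 2 / 2) _.
have G2 := cubic b (expR (- w) - 1) (- w + w ^+ 2 / 2) _.
have {}G1 := G1 ltac:(by rewrite opprD addrA).
have {}G2 := G2 ltac:(by rewrite opprD addrA opprK).
have S0 : 0 <= K * (expR w + expR (- w) - 2) ^+ 2 by rewrite mulr_ge0 ?sqr_ge0.
have E3 : (`|a| + `|b|) * (2 * `|w| ^+ 3) <= e / 2 * w ^+ 2.
  rewrite -(real_normK (num_real w)).
  have -> : (`|a| + `|b|) * (2 * `|w| ^+ 3) =
    (`|a| + `|b|) * 2 * `|w| * `|w| ^+ 2 by ring.
  rewrite ler_wpM2r ?sqr_ge0//.
  have : (`|a| + `|b|) * `|w| <= A * `|w| by rewrite ler_wpM2r.
  by lra.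
have E4 : a * (w + w ^+ 2 / 2) + b * (- w + w ^+ 2 / 2) = p * w + m / 2 * w ^+ 2.
  by rewrite /a /b; field.
by move: G1 G2 S0 E3 E4; lra.
Qed.

Lemma expo_test_le_far (R : realType) (m p K w s D A : R) :
  0 < s -> 0 <= D -> `|m| + `|p| <= A -> A / s + (2 * A + D) / s ^+ 2 <= K ->
  4 * s <= w ^+ 2 -> expo_test m p K w <= - D.
Proof.
move=> s0 D0 mpA Kge ws; rewrite /expo_test.
set a := (m + p) / 2; set b := (m - p) / 2.
have abA : `|a| + `|b| <= A.
  rewrite /a /b !normrM !(@ger0_norm _ 2^-1) ?invr_ge0//.
  by move: (ler_normD m p) (ler_normB m p); lra.
set S := expR w + expR (- w) - 2.
have sS : s <= S by have := cosh_ge w; rewrite -/S; lra.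
have A0 : 0 <= A by apply: le_trans abA; rewrite addr_ge0.
have bound (c z : R) : -1 <= z -> z <= S + 1 -> c * z <= `|c| * (S + 2).
  move=> z1 z2; rewrite (le_trans (ler_norm _))// normrM ler_wpM2l//.
  by rewrite ler_norml; apply/andP; split; lra.
have e1 := expR_gt0 w; have e2 := expR_gt0 (- w).
have G1 : a * (expR w - 1) <= `|a| * (S + 2) by apply: bound; rewrite /S; lra.
have G2 : b * (expR (- w) - 1) <= `|b| * (S + 2) by apply: bound; rewrite /S; lra.
have G3 : (`|a| + `|b|) * (S + 2) <= A * (S + 2) by rewrite ler_wpM2r//; lra.
have G4 : A * S <= A / s * S ^+ 2.
  rewrite -mulrA ler_wpM2l// mulrC ler_pdivlMr// expr2 ler_wpM2l//; lra.
have G5 : 2 * A + D <= (2 * A + D) / s ^+ 2 * S ^+ 2.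
  rewrite -mulrA ler_peMr//; first by rewrite addr_ge0// mulr_ge0.
  rewrite mulrC ler_pdivlMr ?exprn_gt0// mul1r lerXn2r// nnegrE; lra.
have G6 : (A / s + (2 * A + D) / s ^+ 2) * S ^+ 2 <= K * S ^+ 2.
  by rewrite ler_wpM2r// sqr_ge0.
move: G1 G2 G3 G4 G5 G6; lra.
Qed.

(** A value [z] that is bounded below, and at least [p * w + m / 2 * w ^+ 2] when
    [w] is small, is at least the test function with [m] replaced by [m - e]; the
    constant [K] is uniform in [w], [z] and the [p] bounded by [L]. *)
Lemma expo_minorant (R : realType) (L m D dl e : R) :
  0 <= D -> 0 < dl -> 0 < e ->
  exists2 K, 0 <= K & forall p w z : R, `|p| <= L -> - D <= z ->
    (`|w| <= dl -> p * w + m / 2 * w ^+ 2 <= z) ->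
    expo_test (m - e) p K w <= z.
Proof.
move=> D0 dl0 e0.
wlog L0 : L / 0 <= L.
  move=> H; have [/H//|Lneg] := leP 0 L.
  by exists 0 => // p w z pL; have := normr_ge0 p; lra.
pose A := `|m - e| + L.
have A0 : 0 <= A by rewrite addr_ge0.
(* below [d1] the cubic error of the exponentials is absorbed by the slack [e] *)
pose d1 := Num.min dl (Num.min (1 / 2) (e / (4 * A + 1))).
have A1 : 0 < 4 * A + 1 by lra.
have d10 : 0 < d1 by rewrite !lt_min dl0 !divr_gt0.
pose s := d1 ^+ 2 / 4.
have s0 : 0 < s by rewrite divr_gt0 ?exprn_gt0.
exists (A / s + (2 * A + D) / s ^+ 2).
  by rewrite addr_ge0// divr_ge0 ?exprn_ge0 ?addr_ge0 ?mulr_ge0// ltW.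
move=> p w z pL Dz near_z.
have mpA : `|m - e| + `|p| <= A by rewrite /A lerD2l.
have [wd|dw] := leP `|w| d1; last first.
  apply: le_trans Dz; apply: (expo_test_le_far s0 D0 mpA) => //.
  rewrite /s mulrC divfK// -(real_normK (num_real w)).
  by rewrite lerXn2r ?nnegrE// ltW.
move: (wd); rewrite !le_min => /and3P[w1 w2 w3].
apply: le_trans (near_z w1).
rewrite -[in leRHS](subrK e m); apply: (expo_test_le_parabola _ mpA w2).
  by rewrite addr_ge0// divr_ge0 ?exprn_ge0 ?addr_ge0 ?mulr_ge0// ltW.
move: w3; rewrite ler_pdivlMr//; have := normr_ge0 w; nra.
Qed.

(** * Exponential moments of the normal law and the Gaussian one-step bound *)

Lemma ge0_integral_normal_prob (R : realType) (a s : R) (f : R -> \bar R) :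
  measurable_fun setT f -> (forall x, 0 <= f x)%E ->
  (\int[normal_prob a s]_x f x =
   \int[lebesgue_measure]_x (f x * (normal_pdf a s x)%:E))%E.
Proof.
move=> mf f0.
have dom := normal_prob_dominates a s.
rewrite -(Radon_Nikodym_SigmaFinite.change_of_variables dom)//.
have iRN := Radon_Nikodym_SigmaFinite.f_integrable dom.
have mp : measurable_fun setT (EFin \o normal_pdf a s).
  by apply/measurable_EFinP; exact: measurable_normal_pdf.
apply: ae_eq_integral => //.
- by apply: emeasurable_funM => //; exact: measurable_int iRN.
- exact: emeasurable_funM.
- apply: ae_eqe_mul2l => /=.
  apply: integral_ae_eq => //.
  by move=> E _ mE; rewrite -Radon_Nikodym_SigmaFinite.f_integral.
Qed.

(** Completing the square turns the tilted centred density into a shifted one. *)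
Lemma normal_mgf (R : realType) (s t : R) : s != 0 ->
  (\int[normal_prob 0 s]_x (expR (t * x))%:E = (expR (t ^+ 2 * s ^+ 2 / 2))%:E)%E.
Proof.
move=> s0.
have me : measurable_fun setT (fun x : R => (expR (t * x))%:E).
  by apply/measurable_EFinP; apply: measurableT_comp => //; exact: measurable_funM.
rewrite ge0_integral_normal_prob//.
transitivity (\int[lebesgue_measure]_x
    ((expR (t ^+ 2 * s ^+ 2 / 2))%:E * (normal_pdf (t * s ^+ 2) s x)%:E))%E.
  apply: eq_integral => x _; rewrite -!EFinM; congr EFin.
  rewrite !normal_pdfE// /normal_fun mulrCA [RHS]mulrCA -!expRD.
  by congr (_ * expR _); field.
rewrite ge0_integralZl//.
- by rewrite integral_normal_pdf mule1.
- by apply/measurable_EFinP; exact: measurable_normal_pdf.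
- by move=> x _; rewrite lee_fin normal_pdf_ge0.
Qed.

Section has_integral.
Context d (T : measurableType d) (R : realType) (mu : {measure set T -> \bar R}).
Local Open Scope ereal_scope.

(** [f] is integrable with finite integral [v]. *)
Definition has_integral (f : T -> R) (v : R) : Prop :=
  mu.-integrable setT (EFin \o f) /\ \int[mu]_x (f x)%:E = v%:E.

Lemma has_integralD f g u v : has_integral f u -> has_integral g v ->
  has_integral (fun x => f x + g x)%R (u + v)%R.
Proof.
move=> [iff Ef] [ig Eg]; split.
  exact: (integrableD measurableT iff ig).
by under eq_integral do rewrite EFinD; rewrite integralD//= Ef Eg.
Qed.

Lemma has_integralZ f k v : has_integral f v ->
  has_integral (fun x => k * f x)%R (k * v)%R.
Proof.
move=> [iff Ef]; split.
  exact: (integrableZl measurableT k iff).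
by under eq_integral do rewrite EFinM; rewrite integralZl//= Ef.
Qed.

End has_integral.

Lemma has_integral_cst d (T : measurableType d) (R : realType)
  (P : probability T R) k : has_integral P (fun=> k) k.
Proof.
split; first exact: finite_measure_integrable_cst.
rewrite integral_cst//; transitivity (k%:E * 1)%E; last by rewrite mule1.
by congr (_ * _)%E; exact: probability_setT.
Qed.

Lemma has_integral_expR (R : realType) (s t : R) : s != 0 ->
  has_integral (normal_prob 0 s) (fun x => expR (t * x))
   (expR (t ^+ 2 * s ^+ 2 / 2)).
Proof.
move=> s0; split; last exact: normal_mgf.
apply/integrableP; split.
  by apply/measurable_EFinP; apply: measurableT_comp => //; exact: measurable_funM.
under eq_integral do rewrite /= ger0_norm ?expR_ge0//.
by rewrite normal_mgf// ltry.
Qed.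

Lemma has_integral_expR_affine (R : realType) (t h c : R) : 0 < h ->
  has_integral (normal_prob 0 (Num.sqrt h))
    (fun x => expR (t * (Num.sqrt 2 * x + h * c)))
    (expR (h * (t ^+ 2 + t * c))).
Proof.
move=> h0.
have sh0 : Num.sqrt h != 0 by rewrite gt_eqF// sqrtr_gt0.
have := has_integralZ (expR (t * (h * c)))
  (has_integral_expR (t * Num.sqrt 2) sh0).
congr has_integral.
  apply/funext => x.
  rewrite -expRD; congr expR; ring.
rewrite -expRD; congr expR.
rewrite exprMn !sqr_sqrtr// ?ltW//. by field.
Qed.

Lemma expo_test_expand (R : realType) (m p K w : R) :
  expo_test m p K w =
    ((m + p) / 2 + 4 * K) * expR (1 * w) +
    (((m - p) / 2 + 4 * K) * expR (- 1 * w) +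
    ((- K) * expR (2 * w) + ((- K) * expR (- 2 * w) + (- (m + 6 * K))))).
Proof.
rewrite /expo_test.
have e1 : expR (2 * w) = expR w * expR w by rewrite -expRD; congr expR; ring.
have e2 : expR (- 2 * w) = expR (- w) * expR (- w) by rewrite -expRD; congr expR; ring.
have e3 := expRxMexpNx_1 w.
by rewrite mul1r mulN1r e1 e2; field: e3.
Qed.

Lemma has_integral_expo_test (R : realType) (m p K h c : R) : 0 < h ->
  has_integral (normal_prob 0 (Num.sqrt h))
    (fun x => expo_test m p K (Num.sqrt 2 * x + h * c))
    (((m + p) / 2 + 4 * K) * expR (h * (1 + c)) +
    (((m - p) / 2 + 4 * K) * expR (h * (1 - c)) +
    ((- K) * expR (h * (4 + 2 * c)) + ((- K) * expR (h * (4 - 2 * c)) +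
      (- (m + 6 * K)))))).
Proof.
move=> h0.
have -> : (fun x => expo_test m p K (Num.sqrt 2 * x + h * c)) =
  fun x => let w := Num.sqrt 2 * x + h * c in
    ((m + p) / 2 + 4 * K) * expR (1 * w) +
    (((m - p) / 2 + 4 * K) * expR (- 1 * w) +
    ((- K) * expR (2 * w) + ((- K) * expR (- 2 * w) + (- (m + 6 * K))))).
  by apply/funext => x; rewrite expo_test_expand.
do 4 (apply: has_integralD; first (apply: has_integralZ;
  match goal with |- has_integral _ (fun x => expR (?t * _)) _ =>
   have := @has_integral_expR_affine R t h c h0 end;
  by congr (has_integral _ _ (expR _)); ring)).
exact: has_integral_cst.
Qed.

(** The right-hand side is the mean of the test function under the normal law with
    mean [h * c] and variance [2 * h]; its expansion to first order in [h] has no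
    contribution of [K]. *)
Lemma expo_test_mean_lb (R : realType) (L M m K e : R) :
  0 <= K -> 0 < e ->
  exists2 h0, 0 < h0 & forall h p c : R, 0 < h < h0 -> `|p| <= L -> `|c| <= M ->
  h * (p * c + m - e) <=
   (((m + p) / 2 + 4 * K) * expR (h * (1 + c)) +
    (((m - p) / 2 + 4 * K) * expR (h * (1 - c)) +
    ((- K) * expR (h * (4 + 2 * c)) + ((- K) * expR (h * (4 - 2 * c)) +
      (- (m + 6 * K)))))).
Proof.
move=> K0 e0.
wlog [L0 M0] : L M / 0 <= L /\ 0 <= M.
  move=> H; have [|h0 h0p Hh] := H (Num.max L 0) (Num.max M 0).
    by rewrite !le_max !lexx !orbT.
  by exists h0 => // h p c hh pL cM; apply: Hh => //; rewrite le_max ?pL ?cM.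
pose Y := 4 + 2 * M.
pose A := `|m| + L + 10 * K.
have A0 : 0 <= A by rewrite !addr_ge0// mulr_ge0.
have Y0 : 0 < Y by rewrite /Y; lra.
exists (Num.min (1 / (2 * Y)) (e / (2 * A * Y ^+ 2 + 1))).
  have Z0 : 0 < 2 * A * Y ^+ 2 + 1 by rewrite ltr_wpDl// mulr_ge0 ?sqr_ge0// mulr_ge0.
  by rewrite lt_min !divr_gt0// mulr_gt0.
move=> h p c /andP[h0]; rewrite lt_min => /andP[hY he] pL cM.
have hY2 : h * Y <= 1 / 2.
  by move: hY; rewrite ltr_pdivlMr ?mulr_gt0//; lra.
pose q := 2 * (h * Y) ^+ 2.
have bnd a y : `|y| <= h * Y -> a * (1 + y) - `|a| * q <= a * expR y.
  move=> yY.
  have H : `|expR y - (1 + y)| <= q.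
    rewrite ger0_norm; last by have := expR_ge1Dx y; lra.
    have y2 : y <= 1 / 2 by rewrite (le_trans (ler_norm y))// (le_trans yY).
    have := expR_le_quad y2.
    have : y ^+ 2 <= (h * Y) ^+ 2.
      rewrite -(real_normK (num_real y)) lerXn2r ?nnegrE//.
      by rewrite mulr_ge0 ?ltW.
    by rewrite /q; lra.
  have : `|a * (expR y - (1 + y))| <= `|a| * q by rewrite normrM ler_wpM2l.
  by rewrite ler_norml => /andP[+ _]; lra.
have yb z : - Y <= z -> z <= Y -> `|h * z| <= h * Y.
  by move=> z1 z2; rewrite normrM gtr0_norm// ler_pM2l// ler_norml z1.
move: (cM); rewrite ler_norml => /andP[c1 c2].
have B1 := bnd ((m + p) / 2 + 4 * K) (h * (1 + c)) ltac:(by apply: yb; rewrite /Y; lra).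
have B2 := bnd ((m - p) / 2 + 4 * K) (h * (1 - c)) ltac:(by apply: yb; rewrite /Y; lra).
have B3 := bnd (- K) (h * (4 + 2 * c)) ltac:(by apply: yb; rewrite /Y; lra).
have B4 := bnd (- K) (h * (4 - 2 * c)) ltac:(by apply: yb; rewrite /Y; lra).
have qhe : A * q <= h * e.
  have : h * (2 * A * Y ^+ 2 + 1) < e.
    by rewrite -ltr_pdivlMr// ltr_wpDl// mulr_ge0 ?sqr_ge0// mulr_ge0.
  move=> H; rewrite (_ : A * q = h * (h * (2 * A * Y ^+ 2))); last by rewrite /q; ring.
  by rewrite ler_pM2l//; lra.
have q0 : 0 <= q by rewrite mulr_ge0 ?sqr_ge0.
have N : (`|(m + p) / 2 + 4 * K| + `|(m - p) / 2 + 4 * K| + `|- K| + `|- K|) * q <=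
    A * q.
  rewrite ler_wpM2r// normrN (ger0_norm K0).
  have N1 := ler_normD ((m + p) / 2) (4 * K).
  have N2 := ler_normD ((m - p) / 2) (4 * K).
  have N3 := ler_normD m p.
  have N4 := ler_normB m p.
  have N5 : `|4 * K| = 4 * K by rewrite ger0_norm// mulr_ge0.
  have N6 x : `|x / 2| = `|x| / 2 :> R by rewrite normrM (@ger0_norm _ 2^-1) ?invr_ge0.
  rewrite N5 N6 in N1; rewrite N5 N6 in N2.
  rewrite /A; lra.
by move: B1 B2 B3 B4 qhe N; lra.
Qed.

(** If [z] is bounded and [z0 + p * w + m / 2 * w ^+ 2 <= z w] for small [w], then
    the mean of [z] under the normal law with mean [h * c] and variance [2 * h] is
    at least [z0 + h * (p * c + m)], up to an error [h * e]; the bound on [h] is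
    uniform in [p], [c], [z] and [z0]. *)
Lemma normal_taylor_ge (R : realType) (L M m D dl e : R) :
  0 <= D -> 0 < dl -> 0 < e ->
  exists2 h0, 0 < h0 & forall (h p c z0 : R) (z : R -> R),
    0 < h < h0 -> `|p| <= L -> `|c| <= M ->
    measurable_fun [set: R] z -> (forall w, `|z w| <= D) ->
    (forall w, `|w| <= dl -> z0 + p * w + m / 2 * w ^+ 2 <= z w) ->
    `|z0| <= D ->
    ((z0 + h * (p * c + m - e))%:E <=
      \int[normal_prob 0 (Num.sqrt h)]_u (z (Num.sqrt 2 * u + h * c))%:E)%E.
Proof.
move=> D0 dl0 e0.
have e20 : 0 < e / 2 by rewrite divr_gt0.
have D20 : 0 <= 2 * D by rewrite mulr_ge0.
have [K K0 HK] := @expo_minorant R L m (2 * D) dl (e / 2) D20 dl0 e20.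
have [h0 h0p Hh] := @expo_test_mean_lb R L M (m - e / 2) K (e / 2) K0 e20.
exists h0 => // h p c z0 z hh pL cM mz zD zT z0D.
have hp : 0 < h by case/andP: hh.
have [it Et] := has_integralD (has_integral_cst (normal_prob 0 (Num.sqrt h)) z0)
  (has_integral_expo_test (m - e / 2) p K c hp).
apply: (@le_trans _ _ (\int[normal_prob 0 (Num.sqrt h)]_u
   (z0 + expo_test (m - e / 2) p K (Num.sqrt 2 * u + h * c))%:E)%E).
  rewrite Et lee_fin lerD2l.
  by apply: le_trans (Hh h p c hh pL cM); rewrite ler_pM2l//; lra.
have mzc : measurable_fun [set: R] (fun u => z (Num.sqrt 2 * u + h * c)).
  by apply: measurableT_comp => //; apply: measurable_funD.
apply: le_integral => //.
- apply: (@measurable_bounded_integrable _ _ _ (normal_prob 0 (Num.sqrt h)) _ setT) => //.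
    by rewrite -ge0_fin_numE// fin_num_measure.
  exists D; split; first exact: num_real.
  by move=> y Dy x _ /=; apply: (le_trans (zD _)); exact: ltW.
- move=> u _; rewrite lee_fin -lerBrDl; apply: HK => //.
    have := zD (Num.sqrt 2 * u + h * c); move: z0D.
    rewrite !ler_norml => /andP[? ?] /andP[? ?].
    by lra.
  by move=> /zT; lra.
Qed.

(** * Integration of an independent variable *)

(** [G] is a sigma-algebra and [V] a variable of law [N] independent of it. The
    set [Omega] equipped with [G] is a measurable space of its own, so that the
    joint law of the identity and [V] is a product measure, and Tonelli applies. *)
Section integral_indep.
Context d (Omega : measurableType d) (R : realType) (P : probability Omega R).
Context d2 (T2 : measurableType d2).
Variables (G : set (set Omega)) (V : Omega -> T2) (N : probability T2 R).
Hypothesis sG : sigma_algebra setT G.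
Hypothesis GM : G `<=` measurable.
Hypothesis mV : measurable_fun [set: Omega] V.
Hypothesis indep : forall A D, G A -> measurable D ->
  P (A `&` V @^-1` D) = (P A * N D)%E.

Let T1 := g_sigma_algebraType G.

Lemma g_sigma_algebra_mem (A : set Omega) : measurable (A : set T1) -> G A.
Proof. by rewrite /measurable/= (sigma_algebra_id sG). Qed.

Lemma integral_indep (f : T1 * T2 -> \bar R) :
  measurable_fun setT f -> (forall z, 0 <= f z)%E ->
  (\int[P]_w f (w : T1, V w) = \int[P]_w \int[N]_u f (w : T1, u))%E.
Proof.
move=> mf f0.
have mid : measurable_fun [set: Omega] (fun w => w : T1).
  move=> _ Y mY; rewrite setTI; apply: GM; exact: g_sigma_algebra_mem.
pose h (w : Omega) : T1 * T2 := (w : T1, V w).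
have mh : measurable_fun setT h by exact/measurable_fun_pair.
pose X : {mfun Omega >-> T1} := HB.pack (fun w : Omega => w : T1)
  (isMeasurableFun.Build _ _ _ _ _ mid).
pose H : {mfun Omega >-> (T1 * T2)%type} := HB.pack h
  (isMeasurableFun.Build _ _ _ _ _ mh).
pose m1 : probability T1 R := distribution P X.
pose m2 : probability (T1 * T2)%type R := distribution P H.
have E : forall Y, measurable Y -> (m1 \x N)%E Y = m2 Y.
  apply: product_measure_unique => A D mA mD.
  exact: indep (g_sigma_algebra_mem mA) mD.
transitivity (\int[m2]_z f z)%E.
  by rewrite ge0_integral_pushforward.
transitivity (\int[m1 \x N]_z f z)%E.
  by apply: eq_measure_integral => Y mY _; exact/esym/E.
rewrite fubini_tonelli1// ge0_integral_pushforward//.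
- exact: measurable_fun_fubini_tonelli_F.
- by move=> y _; apply: integral_ge0.
Qed.
End integral_indep.

(** * One time step and telescoping *)

(** [q k] is the probability of being still alive at step [k] and [v k] the mean
    of a function with values in [[lo, hi]] at step [k], on survival; a path that
    dies is credited with [hi]. *)
Lemma telescoping_bound (R : realFieldType) (kap lo hi : R) (q v : nat -> R) (n : nat) :
  lo <= hi -> (forall k, 0 <= q k) -> q 0%N <= 1 ->
  (forall k, lo * q k <= v k <= hi * q k) ->
  (forall k, v k + kap * q k <= v k.+1 + hi * (q k - q k.+1)) ->
  \sum_(k < n) kap * q k <= hi - lo.
Proof.
move=> lohi q0 q1 vq step.
have tele : \sum_(k < n) kap * q k <= v n - v 0%N + hi * (q 0%N - q n).
  elim: n => [|n IH]; first by rewrite big_ord0 !subrr add0r mulr0.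
  by rewrite big_ord_recr/=; have := step n; lra.
have /andP[_ vn] := vq n; have /andP[v0 _] := vq 0%N.
have : (hi - lo) * q 0%N <= hi - lo by rewrite ler_piMr// subr_ge0.
lra.
Qed.

Lemma integral_scale_indic d (T : measurableType d) (R : realType)
    (mu : {measure set T -> \bar R}) (A : set T) (k : R) :
  measurable A -> 0 <= k ->
  (\int[mu]_x (k * \1_A x)%:E = k%:E * mu A)%E.
Proof.
move=> mA k0; under eq_integral do rewrite EFinM.
rewrite ge0_integralZl//; last exact/measurable_EFinP.
by have := integral_indic mu measurableT mA; rewrite setIT => ->.
Qed.

Section one_step.
Context d (Omega : measurableType d) (R : realType) (P : probability Omega R).
Variables (G : set (set Omega)) (X : Omega -> R) (V : Omega -> R).
Variable N : probability (measurableTypeR R) R.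
Hypothesis sG : sigma_algebra setT G.
Hypothesis GM : G `<=` measurable.
Hypothesis mV : measurable_fun [set: Omega] V.
Hypothesis indep : forall A (D : set R), G A -> measurable D ->
  P (A `&` V @^-1` D) = (P A * N D)%E.
Hypothesis GX : forall D : set R, measurable D -> G (X @^-1` D).

Let T1 := g_sigma_algebraType G.

Lemma measurable_of_preimages (Y : Omega -> R) :
  (forall D : set R, measurable D -> G (Y @^-1` D)) ->
  measurable_fun [set: T1] (Y : T1 -> R).
Proof.
move=> GY _ D mD; rewrite setTI; apply: sub_sigma_algebra; exact: GY.
Qed.

(** A lower bound on Gaussian means at the points of [[b, a]] passes to the means
    over an event of [G] on which [X] lies in [[b, a]]. *)
Lemma one_step_ge (A : set Omega) (b a h kap : R) (psi c : R -> R) :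
  G A -> (forall w, A w -> b <= X w <= a) ->
  measurable_fun [set: R] psi -> (forall x, 0 <= psi x) ->
  measurable_fun [set: R] c -> 0 <= kap ->
  (forall x, b <= x <= a -> ((psi x + kap)%:E <=
    \int[N]_u (psi (x + (Num.sqrt 2 * u + h * c x)))%:E)%E) ->
  (\int[P]_w (\1_A w * psi (X w))%:E + kap%:E * P A <=
   \int[P]_w (\1_A w * psi (X w + (Num.sqrt 2 * V w + h * c (X w))))%:E)%E.
Proof.
move=> GA AX mpsi psi0 mc kap0 Hstep.
have mX1 := measurable_of_preimages GX.
have mA1 : measurable (A : set T1) by apply: sub_sigma_algebra.
have mA : measurable A by exact: GM.
have mX : measurable_fun [set: Omega] X.
  by move=> _ D mD; rewrite setTI; apply/GM/GX.
pose f (z : T1 * measurableTypeR R) : \bar R :=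
  (\1_A z.1 * psi (X z.1 + (Num.sqrt 2 * z.2 + h * c (X z.1))))%:E.
have mf : measurable_fun setT f.
  have mX' : measurable_fun setT (fun z : T1 * measurableTypeR R => X z.1).
    exact: (measurableT_comp mX1).
  apply/measurable_EFinP; apply: measurable_funM.
    apply: (measurableT_comp (f := \1_A : T1 -> R)) => //.
  apply: measurableT_comp => //; apply: measurable_funD => //.
  apply: measurable_funD; first by apply: measurable_funM.
  apply: measurable_funM => //.
  exact: measurableT_comp.
have f0 z : (0 <= f z)%E by rewrite lee_fin mulr_ge0.
have := @integral_indep _ Omega R P _ (measurableTypeR R) G V N sG GM mV indep f mf f0.
rewrite {1}/f /= => ->.
have E1 : (kap%:E * P A = \int[P]_w (\1_A w * kap)%:E)%E.
  under eq_integral do rewrite mulrC.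
  by rewrite integral_scale_indic.
rewrite E1 -ge0_integralD//; last 4 first.
- by move=> w _; rewrite lee_fin mulr_ge0.
- apply/measurable_EFinP; apply: measurable_funM => //.
  exact: measurableT_comp.
- by move=> w _; rewrite lee_fin mulr_ge0.
- by apply/measurable_EFinP; apply: measurable_funM.
apply: ge0_le_integral => //.
- by move=> w _; rewrite adde_ge0// lee_fin mulr_ge0.
- apply: emeasurable_funD; apply/measurable_EFinP; apply: measurable_funM => //.
  exact: measurableT_comp.
- have mF := measurable_fun_fubini_tonelli_F (m2 := N) f mf f0.
  move=> _ D mD; have := mF measurableT D mD; rewrite !setTI => H.
  by apply: GM; exact: g_sigma_algebra_mem H.
- move=> w _; rewrite -EFinD -mulrDr /f/= indicE.
  have [/set_mem Aw|_] := boolP (w \in A); last first.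
    by rewrite mul0r; apply: integral_ge0 => u _; rewrite lee_fin mul0r.
  rewrite mul1r; apply: (le_trans (Hstep _ (AX w Aw))).
  by under [leRHS]eq_integral do rewrite mul1r.
Qed.
End one_step.

(** * The discretely stopped diffusion *)

(** The projection of the line onto [[b, a]], when [b <= a]. *)
Definition clamp (R : realType) (b a x : R) : R := Num.max b (Num.min x a).

Lemma clamp_in (R : realType) (b a x : R) : b <= a -> b <= clamp b a x <= a.
Proof. by move=> ba; rewrite /clamp le_max lexx/= ge_max ba ge_min lexx orbT. Qed.

Lemma clamp_id (R : realType) (b a x : R) : b <= x <= a -> clamp b a x = x.
Proof. by move=> /andP[bx xa]; rewrite /clamp (min_idPl xa) (max_idPr bx). Qed.

Lemma clamp_homo (R : realType) (b a : R) : {homo clamp b a : x y / x <= y}.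
Proof.
move=> x y xy; rewrite /clamp ge_max le_max lexx/= le_max; apply/orP; right.
by rewrite le_min !ge_min xy lexx orbT.
Qed.

Lemma clamp_continuous (R : realType) (b a : R) : continuous (clamp b a).
Proof.
move=> x; apply: (@continuous_max _ _ (fun=> b) (fun x => Num.min x a)).
  exact: cst_continuous.
by apply: (@continuous_min _ _ id (fun=> a)); [exact: cvg_id|exact: cst_continuous].
Qed.

Lemma continuous_clamp (R : realType) (b a : R) (f : R -> R) : b <= a ->
  (forall x, b <= x <= a -> {for x, continuous f}) ->
  continuous (fun x => f (clamp b a x)).
Proof.
move=> ba cf x; apply: continuous_comp; first exact: clamp_continuous.
exact/cf/clamp_in.
Qed.

Lemma continuous_bounded_itv (R : realType) (b a : R) (f : R -> R) : b <= a ->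
  (forall x, b <= x <= a -> {for x, continuous f}) ->
  exists M, forall x, b <= x <= a -> `|f x| <= M.
Proof.
move=> ba cf; have cfc := continuous_clamp ba cf.
have cn : {within `[b, a], continuous (fun x => `|f (clamp b a x)|)}.
  apply: continuous_subspaceT => x.
  apply: (continuous_comp (cfc x)); exact: norm_continuous.
have [c cba Mc] := EVT_max ba cn.
exists `|f (clamp b a c)| => x xba.
by rewrite -{1}(clamp_id xba); apply: Mc; rewrite in_itv.
Qed.

Section good.
Context (Omega : Type) (R : realType).
Variables (B X : R -> Omega -> R) (c : R -> R) (b a t0 h : R).

(** The times of observation. *)
Definition grid k : R := t0 + h * k%:R.

(** Up to time [grid k], and at the times of observation only, the path stays in
    [[b, a]] and its increments are at least those of [sqrt 2 * B] plus a drift [c]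
    frozen at the beginning of each step. Nothing is asked between these times,
    so that the event involves finitely many variables. *)
Fixpoint good k : set Omega := match k with
  | 0 => [set w | b <= X (grid 0) w <= a]
  | k.+1 => good k `&` [set w | b <= X (grid k.+1) w <= a] `&`
     [set w | X (grid k) w + (Num.sqrt 2 * (B (grid k.+1) w - B (grid k) w) +
               h * c (X (grid k) w)) <= X (grid k.+1) w]
  end.

Lemma good_range k w : good k w -> b <= X (grid k) w <= a.
Proof. by case: k => [//|k] [[]]. Qed.

End good.

Section good_adapted.
Context d (Omega : measurableType d) (R : realType) (P : probability Omega R).
Variables (F : R -> set (set Omega)) (B X : R -> Omega -> R).
Hypothesis filF : is_filtration F.
Hypothesis BM : brownian_motion P F B.
Hypothesis adX : adapted F X.

Lemma good_adapted (c : R -> R) (b a t0 h : R) k : measurable_fun [set: R] c ->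
  0 <= t0 -> 0 <= h -> F (grid t0 h k) (good B X c b a t0 h k).
Proof.
move=> mc t00 h0; have [sF FM Fmono] := filF; have adB := bm_adapted BM.
have g0 j : 0 <= grid t0 h j by rewrite addr_ge0// mulr_ge0.
have gS j : grid t0 h j <= grid t0 h j.+1.
  by rewrite lerD2l ler_wpM2l// ler_nat.
have mle t (f g : Omega -> R) : 0 <= t ->
    measurable_fun [set: g_sigma_algebraType (F t)] (f : g_sigma_algebraType (F t) -> R) ->
    measurable_fun [set: g_sigma_algebraType (F t)] (g : g_sigma_algebraType (F t) -> R) ->
    F t [set w | f w <= g w].
  move=> t0' mf mg; apply: (g_sigma_algebra_mem (sF t t0')).
  have := measurable_funB mg mf => /(_ measurableT `[0, +oo[%classic).
  move=> /(_ (measurable_itv _)); rewrite setTI.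
  by congr measurable; apply/seteqP; split=> w /=; rewrite in_itv/= andbT subr_ge0.
have mZ Z s t : adapted F Z -> 0 <= s -> s <= t ->
    measurable_fun [set: g_sigma_algebraType (F t)] (Z s : g_sigma_algebraType (F t) -> R).
  move=> adZ s0 st; apply: measurable_of_preimages => D mD.
  by apply: (Fmono s t) => //; exact: adZ.
have FI t (A C : set Omega) : 0 <= t -> F t A -> F t C -> F t (A `&` C).
  move=> t0' FA FC; apply: (g_sigma_algebra_mem (sF t t0')).
  by apply: measurableI; apply: sub_sigma_algebra.
have rangeF j : F (grid t0 h j) [set w | b <= X (grid t0 h j) w <= a].
  rewrite (_ : mkset _ = [set w | b <= X (grid t0 h j) w] `&`
    [set w | X (grid t0 h j) w <= a]); last first.
    by apply/seteqP; split => w /= => [/andP|] [-> ->].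
  by apply: FI => //; apply: mle => //; apply: mZ.
elim: k => [|k IH]; first exact: rangeF.
apply: (FI) => //; first apply: (FI) => //.
  exact: Fmono IH.
apply: mle => //; last exact: mZ.
have mXk := mZ X _ _ adX (g0 k) (gS k).
have mBk := mZ B _ _ adB (g0 k) (gS k).
have mBk' := mZ B _ _ adB (g0 k.+1) (lexx _).
apply: measurable_funD => //; apply: measurable_funD; apply: measurable_funM => //.
  exact: measurable_funB.
exact: measurableT_comp.
Qed.

End good_adapted.

(** * The mean number of good steps *)

(** The drift [1 / g], slightly slowed down and frozen outside [[b, a]]. *)
Definition slow_drift (R : realType) (g : R -> R) (b a e x : R) : R :=
  (1 - e) / g (clamp b a x).

Section sum_good.
Context d (Omega : measurableType d) (R : realType) (P : probability Omega R).
Variables (F : R -> set (set Omega)) (B X : R -> Omega -> R).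
Hypothesis filF : is_filtration F.
Hypothesis BM : brownian_motion P F B.
Hypothesis adX : adapted F X.
Variables (phi g : R -> R) (l r m lo hi : R).
Hypothesis phid : forall x, l < x < r -> is_derive x 1 phi (g x).
Hypothesis gc : forall x, l < x < r -> {for x, continuous g}.
Hypothesis g0 : forall x, l < x < r -> 0 < g x.
Hypothesis tay : forall x y, l < x < r -> l < y < r ->
  phi x + g x * (y - x) + m / 2 * (y - x) ^+ 2 <= phi y.
Hypothesis mono : forall x y, l < x < r -> l < y < r -> x <= y -> phi x <= phi y.
Hypothesis lo0 : 0 <= lo.
Hypothesis lohi : lo <= hi.
Hypothesis phib : forall x, l < x < r -> lo <= phi x <= hi.

(** Summation of the one-step bounds. A good path is observed in [[b, a]] only, and a
    path that stops being good is credited with [hi]: neither the behaviour of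
    [phi] near [l] and [r] nor the later positions of the path matter. *)
Lemma sum_good_le (b a e : R) :
  l < b -> b <= a -> a < r -> 0 < e -> 0 <= 1 + m - 2 * e ->
  exists2 h0, 0 < h0 & forall h t0 n, 0 < h < h0 -> 0 <= t0 ->
  \sum_(k < n) (h * (1 + m - 2 * e)) *
     fine (P (good B X (slow_drift g b a e) b a t0 h k)) <= hi - lo.
Proof.
move=> lb ba ar e0 kap0.
(* [psi] coincides with [phi] on a neighbourhood of [[b, a]], is monotone,
   continuous and bounded on the whole line *)
pose b' := (l + b) / 2; pose a' := (a + r) / 2.
have lb' : l < b' by rewrite /b'; lra.
have b'b : b' < b by rewrite /b'; lra.
have aa' : a < a' by rewrite /a'; lra.
have a'r : a' < r by rewrite /a'; lra.
have b'a' : b' <= a' by lra.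
have in1 x : b' <= x <= a' -> l < x < r by move=> /andP[? ?]; apply/andP; split; lra.
have in2 x : b <= x <= a -> b' <= x <= a' by move=> /andP[? ?]; apply/andP; split; lra.
have in3 x : b <= x <= a -> l < x < r by move/in2/in1.
pose psi x := phi (clamp b' a' x).
have cpsi : continuous psi.
  apply: continuous_clamp => // x /in1 /phid; exact: is_derive_continuous.
have mpsi : measurable_fun [set: R] psi by exact: continuous_measurable_fun.
have psib x : lo <= psi x <= hi by apply/phib/in1/clamp_in.
have psimono x y : x <= y -> psi x <= psi y.
  by move=> xy; apply: mono; [exact/in1/clamp_in|exact/in1/clamp_in|exact: clamp_homo].
have psi0 x : 0 <= psi x by have /andP[+ _] := psib x; exact: le_trans.
have cc x : b <= x <= a -> {for x, continuous (fun x => (1 - e) / g x)}.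
  move=> /in3 xlr; apply: cvgM; first exact: cvg_cst.
  by apply: cvgV; [rewrite gt_eqF// g0|exact: gc].
have cslow : continuous (slow_drift g b a e) by exact: continuous_clamp ba cc.
have mslow : measurable_fun [set: R] (slow_drift g b a e) by exact: continuous_measurable_fun.
have [L HL] := continuous_bounded_itv ba (fun x xba => gc (in3 x xba)).
have [M HM] := continuous_bounded_itv ba cc.
have hi0 : 0 <= hi by exact: le_trans lohi.
pose dl := Num.min (b - b') (a' - a).
have dl0 : 0 < dl by rewrite lt_min !subr_gt0 b'b.
have [h0 h0p Hh] := @normal_taylor_ge R L M m hi dl e hi0 dl0 e0.
exists h0 => // h t0 n hh t00.
have hp : 0 < h by case/andP: hh.
set c := slow_drift g b a e; set Gd := good B X c b a t0 h.
set t := grid t0 h.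
have [sF FM Fmono] := filF.
have tk0 k : 0 <= t k by rewrite addr_ge0// mulr_ge0// ltW.
have tS k : t k.+1 - t k = h by rewrite /t /grid -natr1; ring.
have FG k : F (t k) (Gd k) by apply: (good_adapted filF BM adX) => //; exact: ltW.
have mG k : measurable (Gd k) by apply: (FM (t k)).
have mZ Z s : adapted F Z -> 0 <= s -> measurable_fun [set: Omega] (Z s).
  by move=> adZ s0 _ D mD; rewrite setTI; apply: (FM s) => //; exact: adZ.
pose I k := (\int[P]_w (\1_(Gd k) w * psi (X (t k) w))%:E)%E.
have mI k : measurable_fun [set: Omega] (fun w => (\1_(Gd k) w * psi (X (t k) w))%:E).
  apply/measurable_EFinP; apply: measurable_funM => //.
  by apply: measurableT_comp => //; exact: mZ.
have I0 k w : (0 <= (\1_(Gd k) w * psi (X (t k) w))%:E)%E by rewrite lee_fin mulr_ge0.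
have Ifin k : (lo%:E * P (Gd k) <= I k <= hi%:E * P (Gd k))%E.
  have mc x : measurable_fun [set: Omega] (fun w => (x * \1_(Gd k) w)%:E).
    by apply/measurable_EFinP; apply: measurable_funM.
  have intc x : 0 <= x -> (x%:E * P (Gd k) = \int[P]_w (x * \1_(Gd k) w)%:E)%E.
    by move=> x0; rewrite integral_scale_indic.
  rewrite !intc//; apply/andP; split; apply: ge0_le_integral => //.
  - by move=> w _; rewrite lee_fin mulr_ge0.
  - move=> w _; rewrite lee_fin mulrC ler_wpM2l//.
    by case/andP: (psib (X (t k) w)).
  - move=> w _; rewrite lee_fin mulrC ler_wpM2r//.
    by case/andP: (psib (X (t k) w)).
have PE k : P (Gd k) = (fine (P (Gd k)))%:E by rewrite fineK// fin_num_measure.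
have IE k : I k = (fine (I k))%:E.
  rewrite fineK//; have /andP[I1 I2] := Ifin k.
  by rewrite fin_numElt (lt_le_trans _ I1) ?(le_lt_trans I2)// PE -EFinM ?ltNyr ?ltry.
apply: (@telescoping_bound _ (h * (1 + m - 2 * e)) lo hi
  (fun k => fine (P (Gd k))) (fun k => fine (I k)) n lohi).
- by move=> k; rewrite fine_ge0.
- by rewrite -lee_fin -PE probability_le1.
- by move=> k; move: (Ifin k); rewrite IE PE -!EFinM !lee_fin.
move=> k.
have tkk : t k < t k.+1 by have := tS k; lra.
have GS : Gd k.+1 `<=` Gd k by move=> w [[]].
pose V w := B (t k.+1) w - B (t k) w.
have mV : measurable_fun [set: Omega] V.
  by apply: measurable_funB; apply: (mZ B) => //; exact: bm_adapted BM.
have indepV (A : set Omega) (D : set R) : F (t k) A -> measurable D ->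
    P (A `&` V @^-1` D) = (P A * normal_prob 0 (Num.sqrt h) D)%E.
  move=> FA mD; rewrite (bm_indep BM (tk0 k) tkk FA mD).
  by rewrite (bm_gaussian BM (tk0 k) tkk mD) tS.
pose N : probability (measurableTypeR R) R := normal_prob 0 (Num.sqrt h).
have := one_step_ge (N := N) (kap := h * (1 + m - 2 * e)) (h := h) (c := c) (sF _ (tk0 k))
  (FM _ (tk0 k)) mV indepV (fun D mD => adX (tk0 k) mD) (FG k)
  (@good_range _ _ _ _ _ _ _ _ _ k) mpsi psi0 mslow.
have kh : 0 <= h * (1 + m - 2 * e) by rewrite mulr_ge0// ltW.
move=> /(_ kh) H1.
have {}H1 := H1 _.
have {H1} : (I k + (h * (1 + m - 2 * e))%:E * P (Gd k) <=
    \int[P]_w (\1_(Gd k) w * psi (X (t k) w + (Num.sqrt 2 * V w + h * c (X (t k) w))))%:E)%E.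
  apply: H1 => x xba.
  have Ex : psi x = phi x by rewrite /psi clamp_id// in2.
  have cx : c x = (1 - e) / g x by rewrite /c /slow_drift clamp_id.
  have gx0 := g0 (in3 _ xba).
  have := Hh h (g x) (c x) (psi x) (fun w => psi (x + w)) hh (HL _ xba).
  rewrite {1}cx => /(_ (HM _ xba)).
  have -> : g x * c x + m - e = 1 + m - 2 * e.
    by rewrite cx; field; rewrite gt_eqF.
  apply.
  - by apply: measurableT_comp => //; exact: measurable_funD.
  - by move=> w; rewrite ger0_norm//; case/andP: (psib (x + w)).
  - move=> w; rewrite /dl le_min => /andP[w1 w2].
    have xw : b' <= x + w <= a'.
      move: w1 w2 xba; rewrite !ler_norml => /andP[? ?] /andP[? ?] /andP[? ?].
      by apply/andP; split; lra.
    have := tay (in3 _ xba) (in1 _ xw).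
    by rewrite Ex /psi (clamp_id xw) (addrAC x w) subrr add0r.
  - by rewrite ger0_norm//; case/andP: (psib x).
move=> /le_trans H1.
have mD : measurable (Gd k `\` Gd k.+1) by exact: measurableD.
have PD : (P (Gd k `\` Gd k.+1) = (fine (P (Gd k)) - fine (P (Gd k.+1)))%:E)%E.
  by rewrite measureD// ?setIidr// -?ge0_fin_numE ?fin_num_measure// EFinB -!PE.
have mDi : measurable_fun [set: Omega] (fun w => (hi * \1_(Gd k `\` Gd k.+1) w)%:E).
  by apply/measurable_EFinP; apply: measurable_funM.
have IntD : (\int[P]_w (hi * \1_(Gd k `\` Gd k.+1) w)%:E = hi%:E * P (Gd k `\` Gd k.+1))%E.
  exact: integral_scale_indic.
rewrite -lee_fin !EFinD EFinM (EFinM hi) -IE -PE -IE -PD.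
apply: H1; rewrite -IntD -ge0_integralD//; last first.
  by move=> w _; rewrite lee_fin mulr_ge0.
apply: ge0_le_integral => //.
- by move=> w _; rewrite lee_fin mulr_ge0.
- apply/measurable_EFinP; apply: measurable_funM => //.
  apply: measurableT_comp => //; apply: measurable_funD; first exact: mZ.
  apply: measurable_funD; apply: measurable_funM => //.
  by apply: measurableT_comp => //; exact: mZ.
- exact: emeasurable_funD.
move=> w _; rewrite -EFinD lee_fin !indicE !in_setD.
have [Gk|] := boolP (w \in Gd k); last first.
  by rewrite mul0r => ?; rewrite addr_ge0// mulr_ge0.
rewrite mul1r; have [/set_mem Gk1|Gk1] /= := boolP (w \in Gd k.+1).
  rewrite mulr0 addr0 mul1r; apply: psimono.
  by case: Gk1.
rewrite mul0r add0r mulr1.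
by case/andP: (psib (X (t k) w + (Num.sqrt 2 * V w + h * c (X (t k) w)))).
Qed.
End sum_good.

(** * Pathwise consequences of the equation *)

(** [x] is a path driven by [be] with drift [f], which is continuous and positive at
    positive times; its value at time [0] is arbitrary, and it may be unbounded
    near [0]. *)
Section pathwise.
Context (R : realType).
Variables (x be f : R -> R) (r : R).
Hypothesis cf : forall s, 0 < s <= r -> {for s, continuous f}.
Hypothesis f0 : forall s, 0 < s <= r -> 0 < f s.
Hypothesis sde : forall t, 0 <= t <= r ->
  ((x t)%:E = (x 0 + be t)%:E + \int[lebesgue_measure]_(s in `[0%R, t]) (f s)%:E)%E.

(** The integral up to the first time is finite because the path is. *)
Lemma integral_path_split s t : 0 < s -> s <= t -> t <= r ->
  (x t - x s - (be t - be s))%:E = (\int[lebesgue_measure]_(u in `]s, t]) (f u)%:E)%E.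
Proof.
move=> s0 st tr.
have mf z : z <= r -> measurable_fun `]0, z]%classic (EFin \o f).
  move=> zr; apply/measurable_EFinP.
  apply: subspace_continuous_measurable_fun; first exact: measurable_itv.
  apply: continuous_in_subspaceT => u /set_mem/= /[!in_itv]/= /andP[u0 uz].
  by apply: cf; rewrite u0 (le_trans uz).
have Iz z : z <= r ->
   (\int[lebesgue_measure]_(u in `[0%R, z]) (f u)%:E =
    \int[lebesgue_measure]_(u in `]0%R, z]) (f u)%:E)%E.
  by move=> zr; rewrite -integral_itv_obnd_cbnd//; exact: mf.
have sr : s <= r by exact: le_trans tr.
have t0 : 0 < t by exact: lt_le_trans st.
have Es : (x s)%:E = ((x 0 + be s)%:E + \int[lebesgue_measure]_(u in `]0%R, s]) (f u)%:E)%E.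
  by rewrite -Iz//; apply: sde; rewrite ltW.
have Et : (x t)%:E = ((x 0 + be t)%:E + \int[lebesgue_measure]_(u in `]0%R, t]) (f u)%:E)%E.
  by rewrite -Iz//; apply: sde; rewrite ltW.
have U : `]0, t]%classic = `]0, s]%classic `|` `]s, t]%classic.
  apply/seteqP; split => u /=; rewrite !in_itv/=.
    by move=> /andP[u0 ut]; have [us|us] := leP u s; [left|right]; rewrite ?u0 ?ut.
  by move=> [/andP[u0 us]|/andP[su ut]]; rewrite ?u0 ?ut ?(le_trans us)// (lt_trans s0).
have mfU : measurable_fun (`]0, s]%classic `|` `]s, t]%classic) (EFin \o f).
  by rewrite -U; exact: mf.
have f0U u : (`]0, s]%classic `|` `]s, t]%classic) u -> (0 <= (EFin \o f) u)%E.
  rewrite -U /= in_itv/= => /andP[u0 ut].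
  by rewrite lee_fin ltW// f0// u0 (le_trans ut).
have dis : [disjoint `]0%R, s]%classic & `]s, t]%classic].
  rewrite disj_set2E; apply/eqP/seteqP; split => u //=; rewrite !in_itv/=.
  by move=> [/andP[_ us] /andP[su _]]; move: (le_lt_trans us su); rewrite ltxx.
have := @ge0_integral_setU _ _ R lebesgue_measure _ _ (measurable_itv _)
  (measurable_itv _) _ mfU f0U dis.
rewrite -U => IU; rewrite IU /= in Et.
have solve (I J : \bar R) : (x s)%:E = ((x 0 + be s)%:E + I)%E ->
    (x t)%:E = ((x 0 + be t)%:E + (I + J))%E ->
    (x t - x s - (be t - be s))%:E = J.
  move: I J => [I||] [J||] //=; rewrite -!EFinD => -[->] [->]; congr EFin; ring.
exact: solve Es Et.
Qed.

(** Over short steps the drift keeps at least [1 - e] times its initial value. *)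
Lemma path_increment_ge (e t0 : R) : 0 < e -> 0 < t0 -> t0 <= r ->
  exists2 h0, 0 < h0 & forall s t, t0 <= s -> s <= t -> t <= r -> t - s < h0 ->
    x s + (be t - be s + (t - s) * ((1 - e) * f s)) <= x t.
Proof.
move=> e0 t00 t0r.
have cK s : `[t0, r]%classic s -> {for s, continuous f}.
  by rewrite /= in_itv/= => /andP[t0s sr]; apply: cf; rewrite sr (lt_le_trans t00).
have fwithin : {within `[t0, r], continuous f}.
  by apply: continuous_in_subspaceT => s /set_mem; exact: cK.
have [c cK' fc] := EVT_min t0r fwithin.
have fc0 : 0 < f c.
  by move: cK'; rewrite in_itv/= => /andP[t0c cr]; apply: f0; rewrite cr (lt_le_trans t00).
have [h0 h0p Hf] := compact_unif_continuous (@segment_compact R t0 r) cK (mulr_gt0 e0 fc0).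
exists h0 => // s t t0s st tr th.
have s0 : 0 < s by exact: lt_le_trans t0s.
have sK : `[t0, r]%classic s by rewrite /= in_itv/= t0s (le_trans st).
have fs : f c <= f s by apply: fc.
rewrite -subr_ge0.
suff : (((t - s) * ((1 - e) * f s))%:E <= (x t - x s - (be t - be s))%:E)%E.
  by rewrite lee_fin; lra.
rewrite integral_path_split//.
have mf : measurable_fun `]s, t]%classic f.
  apply: subspace_continuous_measurable_fun; first exact: measurable_itv.
  apply: continuous_in_subspaceT => u /set_mem/= /[!in_itv]/= /andP[u0 uz].
  by apply: cf; rewrite (lt_trans s0 u0) (le_trans uz).
have bd u : s < u -> u <= t -> (1 - e) * f s <= f u.
  move=> su ut; have us : `|u - s| < h0.
    by rewrite ger0_norm ?subr_ge0 ?ltW// (le_lt_trans _ th)// lerD2r.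
  have := Hf s u sK us; rewrite ltr_norml => /andP[H _].
  have : e * f c <= e * f s by rewrite ler_pM2l.
  by lra.
have [fneg|fpos] := leP ((1 - e) * f s) 0.
  apply: (@le_trans _ _ 0%E); first by rewrite lee_fin mulr_ge0_le0// subr_ge0.
  apply: integral_ge0 => u; rewrite /= in_itv/= => /andP[su ut].
  by rewrite lee_fin ltW// f0// (lt_trans s0 su) (le_trans ut).
apply: (@le_trans _ _ (\int[lebesgue_measure]_(u in `]s, t]) (((1 - e) * f s))%:E)%E).
  rewrite integral_cst//= lebesgue_measure_itv/= lte_fin.
  have [s_t|ts] := ltP s t; first by rewrite -EFinD -EFinM mulrC.
  have -> : t - s = 0 by apply/eqP; rewrite subr_eq0 eq_le ts.
  by rewrite mule0 mul0r.
apply: ge0_le_integral => //.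
- by move=> u _; rewrite lee_fin ltW.
- exact/measurable_EFinP.
- by move=> u; rewrite /= in_itv/= => /andP[su ut]; rewrite lee_fin bd.
Qed.
End pathwise.

(** * Lower limits and integrals *)

Section limn_einf.
Context (R : realType).
Implicit Types (u : (\bar R)^nat) (c : \bar R).
Local Open Scope ereal_scope.

Lemma cvg_einfs_limn u : einfs u n @[n --> \oo] --> limn_einf u.
Proof. by rewrite limn_einf_lim; exact: is_cvg_einfs. Qed.

Lemma limn_einfE u : limn_einf u = ereal_sup (range (einfs u)).
Proof. by rewrite limn_einf_lim; apply/cvg_lim => //; exact: cvg_einfs_sup. Qed.

Lemma limn_einf_ge u c N :
  (forall n, (N <= n)%N -> c <= u n) -> c <= limn_einf u.
Proof.
move=> cu; rewrite limn_einfE; apply: (@le_trans _ _ (einfs u N)).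
  by apply: le_ereal_inf_tmp => _ [n /= Nn <-]; exact: cu.
by apply: ereal_sup_ubound; exists N.
Qed.

Lemma limn_einf_le u c : (forall n, u n <= c) -> limn_einf u <= c.
Proof.
move=> uc; rewrite limn_einfE; apply: ge_ereal_sup => _ [n _ <-].
by apply: le_trans (uc n); apply: ereal_inf_lbound; exists n => /=.
Qed.

Lemma measurable_limn_einf d (T : measurableType d) (f : (T -> \bar R)^nat) :
  (forall n, measurable_fun [set: T] (f n)) ->
  measurable_fun [set: T] (fun x => limn_einf (f ^~ x)).
Proof.
move=> mf; apply: (emeasurable_fun_cvg (fun n x => einfs (f ^~ x) n)).
  by move=> n; exact: measurable_fun_einfs.
by move=> x _; exact: cvg_einfs_limn.
Qed.
End limn_einf.

Section ae_ge0_integral_le.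
Import HBNNSimple.

(** The smaller function need not be measurable. *)
Lemma ae_ge0_integral_le d (T : measurableType d) (R : realType)
    (mu : {measure set T -> \bar R}) (f g : T -> \bar R) :
  (forall x, 0 <= f x)%E -> (forall x, 0 <= g x)%E ->
  measurable_fun [set: T] g -> {ae mu, forall x, (f x <= g x)%E} ->
  (\int[mu]_x f x <= \int[mu]_x g x)%E.
Proof.
move=> f0 g0 mg fg; rewrite [leLHS]ge0_integralTE//.
apply: ge_ereal_sup => _ [h /= hf <-].
rewrite -(integralT_nnsfun mu h).
have mh : measurable_fun [set: T] (EFin \o h) by exact/measurable_EFinP.
apply: ae_ge0_le_integral => //.
  by move=> x _; rewrite lee_fin.
by apply: filterS fg => x fgx _; exact: le_trans (hf x) fgx.
Qed.

End ae_ge0_integral_le.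

Lemma sum_grid_ge (R : realFieldType) (h T : R) (A : nat -> bool) n :
  0 <= h -> (forall k, h * k%:R <= T -> A k) ->
  Num.min (h * n%:R) T <= \sum_(k < n) h * (A k)%:R.
Proof.
move=> h0 HA; elim: n => [|n IH].
  by rewrite big_ord0 mulr0 ge_min lexx.
rewrite big_ord_recr/=; have [hnT|Tn] := leP (h * n%:R) T.
  rewrite HA// mulr1 ge_min -natr1 mulrDr mulr1 lerD2r.
  by rewrite (min_idPl hnT) in IH; rewrite IH.
rewrite (min_idPr (ltW Tn)) in IH.
by rewrite ge_min; apply/orP; right; rewrite ler_wpDr// mulr_ge0.
Qed.

(** * The mean hitting time *)

Lemma eventually_lt_nat (R : realType) (x : R) : exists N, forall n, (N <= n)%N -> x < n%:R.
Proof.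
exists (Num.trunc x).+1 => n Nn; apply: (lt_le_trans (truncnS_gt x)).
by rewrite ler_nat.
Qed.

Lemma continuous_paths_at (R : realType) d (Omega : measurableType d) (X : R -> Omega -> R)
  (w : Omega) s : continuous_paths X -> 0 < s -> {for s, continuous (X ^~ w)}.
Proof.
move=> cX s0.
have sub : (`]0, +oo[%classic : set R) `<=` `[0, +oo[%classic.
  by move=> u /=; rewrite !in_itv/= !andbT => /ltW.
have := continuous_subspaceW sub (cX w).
rewrite continuous_open_subspace; last exact: interval_open.
by apply; rewrite inE/= in_itv/= s0.
Qed.

(** A path that stays in [[b, a]] between [t0] and [r] is good up to [r], if the
    step is small enough; how small does not depend on [b] and [a]. *)
Lemma good_of_path (R : realType) (Omega : Type) (B X : R -> Omega -> R) (w : Omega)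
    (g : R -> R) (r t0 e : R) :
  (forall s, 0 < s <= r -> {for s, continuous (fun s => (g (X s w))^-1)}) ->
  (forall s, 0 < s <= r -> 0 < (g (X s w))^-1) ->
  (forall t, 0 <= t <= r -> ((X t w)%:E = (X 0 w + Num.sqrt 2 * B t w)%:E +
     \int[lebesgue_measure]_(s in `[0%R, t]) ((g (X s w))^-1)%:E)%E) ->
  0 < e -> 0 < t0 -> t0 <= r ->
  exists2 h0, 0 < h0 & forall h b a, 0 < h < h0 ->
    (forall s, t0 <= s <= r -> b <= X s w <= a) ->
    forall k, grid t0 h k <= r -> good B X (slow_drift g b a e) b a t0 h k w.
Proof.
move=> cf f0 sde e0 t00 t0r.
have [h0 h0p H] := path_increment_ge cf f0 sde e0 t00 t0r.
exists h0 => // h b a /andP[hp hh] Xba.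
have t0k k : t0 <= grid t0 h k by rewrite lerDl mulr_ge0// ltW.
have gS k : grid t0 h k.+1 - grid t0 h k = h by rewrite /grid -natr1; ring.
elim=> [|k IH] kr; first by apply: Xba; rewrite t0k.
have kk : grid t0 h k <= grid t0 h k.+1 by have := gS k; lra.
split; first split; first by apply: IH; exact: le_trans kr.
  by apply: Xba; rewrite t0k.
have := H _ _ (t0k k) kk kr; rewrite gS => /(_ hh) /=.
rewrite /slow_drift clamp_id; last by apply: Xba; rewrite t0k (le_trans kk).
by rewrite -mulrBr.
Qed.

Section mean_hitting_time.
Context (R : realType) (phi : R -> R).
Hypothesis phi_ge0 : forall x, x \in `[0, pi] -> 0 <= phi x.
Hypothesis phi_C2 : C2_on `[0, pi] phi.
Hypothesis phi_incr : {in `[0, pi] &, {homo phi : x y / x < y}}.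
Hypothesis dphi_gt0 : forall x, x \in `]0, pi[ -> 0 < derive_within `[0, pi] phi x.
Context (d : measure_display) (Omega : measurableType d)
  (P : probability Omega R) (F : R -> set (set Omega)) (B X : R -> Omega -> R).
Hypothesis XD : diffusion P phi 0 F B X.
Hypothesis Xpos : {ae P, forall w, forall t : R, 0 < t ->
       (t%:E <= hitting_time X pi w)%E -> X t w <> 0}.
Variable m : R.
Hypothesis m_min : is_min
   (derive_within `[0, pi] (derive_within `[0, pi] phi) @` `[0, pi]) m.

Let g := derive_within `[0, pi] phi.

Let in_0pi (x : R) : 0 < x < pi -> x \in `[0, pi].
Proof. by rewrite in_itv/= => /andP[/ltW -> /ltW ->]. Qed.

Let phid x : 0 < x < pi -> is_derive x 1 phi (g x).
Proof.
move=> xpi; apply: is_derive_within => //.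
by case: phi_C2 => + _ _; apply; exact: in_0pi.
Qed.

Let gd x : 0 < x < pi -> is_derive x 1 g (derive_within `[0, pi] g x).
Proof.
move=> xpi; apply: is_derive_within => //.
by case: phi_C2 => _ + _; apply; exact: in_0pi.
Qed.

Let gc x : 0 < x < pi -> {for x, continuous g}.
Proof. by move/gd; exact: is_derive_continuous. Qed.

Let g0 x : 0 < x < pi -> 0 < g x.
Proof. by move=> xpi; apply: dphi_gt0; rewrite in_itv. Qed.

Let tay x y : 0 < x < pi -> 0 < y < pi ->
  phi x + g x * (y - x) + m / 2 * (y - x) ^+ 2 <= phi y.
Proof.
apply: (taylor2_ge phid gd) => z /in_0pi zpi.
by case: m_min => _; apply; exists z.
Qed.

Let phi_mono x y : x \in `[0, pi] -> y \in `[0, pi] -> x <= y -> phi x <= phi y.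
Proof.
by move=> xp yp; rewrite le_eqVlt => /orP[/eqP->//|xy]; apply/ltW/phi_incr.
Qed.

Let pi0 : 0 < pi :> R := pi_gt0 R.

Let in0 : (0 : R) \in `[0, pi]. Proof. by rewrite in_itv/= lexx ltW. Qed.
Let inpi : (pi : R) \in `[0, pi]. Proof. by rewrite in_itv/= lexx ltW. Qed.

Let C := phi pi - phi 0.

(* the diffusion is observed in [[level n, pi - level n]] *)
Let level (n : nat) : R := pi / (n%:R + 3).

Lemma level_gt0 n : 0 < level n.
Proof. by rewrite divr_gt0// ltr_wpDl. Qed.

Lemma level_le n : level n <= pi - level n.
Proof.
have : level n <= pi / 2.
  rewrite ler_pM2l// lef_pV2 ?posrE ?ltr_wpDl//.
  by have := ler0n R n; lra.
lra.
Qed.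

(** [p.1] is the time step and [p.2] the number of steps; the condition
    [n <= p.1 * p.2] lets the horizon tend to infinity with [n]. *)
Lemma exists_good_steps (e : R) n : 0 < e -> 0 < 1 + m - 2 * e -> exists p : R * nat,
  [/\ 0 < p.1, p.1 < (n%:R + 1)^-1, n%:R <= p.1 * p.2%:R & forall t0, 0 <= t0 ->
   \sum_(k < p.2) p.1 * fine (P (good B X
      (slow_drift g (level n) (pi - level n) e) (level n) (pi - level n) t0 p.1 k))
   <= C / (1 + m - 2 * e)].
Proof.
move=> e0 kap0.
have lohi : phi 0 <= phi pi by apply: phi_mono => //; exact: ltW.
have phib x : 0 < x < pi -> phi 0 <= phi x <= phi pi.
  by move=> /[dup] /andP[/ltW x0 /ltW xpi] /in_0pi xi; rewrite !phi_mono.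
have api : pi - level n < pi by rewrite ltrBlDr ltrDl level_gt0.
have [h0 h0p Hh] := sum_good_le (dif_filtration XD) (dif_brownian XD)
  (dif_adapted XD) phid gc g0 tay
  (fun x y xp yp => phi_mono (in_0pi xp) (in_0pi yp)) (phi_ge0 in0) lohi phib
  (level_gt0 n) (level_le n) api e0 (ltW kap0).
pose h := Num.min h0 (n%:R + 1)^-1 / 2.
have m0 : 0 < Num.min h0 (n%:R + 1)^-1 by rewrite lt_min h0p invr_gt0 ltr_wpDl.
have hp : 0 < h by rewrite divr_gt0.
have hm : h < Num.min h0 (n%:R + 1)^-1 by rewrite /h; lra.
move: (hm); rewrite lt_min => /andP[hh0 hn].
have [N HN] := eventually_lt_nat (n%:R / h).
exists (h, N); split => //=.
  by have := HN N (leqnn _); rewrite ltr_pdivrMr// mulrC => /ltW.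
move=> t0 t00; rewrite ler_pdivlMr// mulr_suml.
have := Hh h t0 N; rewrite hp hh0 => /(_ isT t00); apply: le_trans.
by apply: ler_sum => k _; rewrite mulrAC.
Qed.

Lemma hitting_time_ge0 w : (0 <= hitting_time X pi w)%E.
Proof. by apply: le_ereal_inf_tmp => _ [t [t0 _] <-]; rewrite lee_fin. Qed.

Lemma before_hitting w s r : 0 <= s -> s <= r ->
  (r%:E < hitting_time X pi w)%E -> X s w <> pi.
Proof.
move=> s0 sr rt Xs; have : (hitting_time X pi w <= s%:E)%E.
  by apply: ereal_inf_lbound; exists s.
by move=> /(lt_le_trans rt); rewrite lte_fin ltNge sr.
Qed.

(** The time spent good, [S n], has a bounded mean, and its lower limit is at least
    the hitting time minus [t0] for almost every path. *)
Lemma mean_hitting_time_le (e t0 : R) : 0 < e -> 0 < 1 + m - 2 * e -> 0 < t0 ->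
  (\int[P]_w hitting_time X pi w <= t0%:E + (C / (1 + m - 2 * e))%:E)%E.
Proof.
move=> e0 kap0 t00.
have /choice[p Hp] : forall n, exists p : R * nat,
  [/\ 0 < p.1, p.1 < (n%:R + 1)^-1, n%:R <= p.1 * p.2%:R & forall t0, 0 <= t0 ->
   \sum_(k < p.2) p.1 * fine (P (good B X
      (slow_drift g (level n) (pi - level n) e) (level n) (pi - level n) t0 p.1 k))
   <= C / (1 + m - 2 * e)] by move=> n; exact: exists_good_steps.
pose G n k := good B X (slow_drift g (level n) (pi - level n) e)
  (level n) (pi - level n) t0 (p n).1 k.
pose S n w := \sum_(k < (p n).2) (p n).1 * \1_(G n k) w.
have [sF FM Fmono] := dif_filtration XD.
have mG n k : measurable (G n k).
  have [p0 _ _ _] := Hp n.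
  have gr0 : 0 <= grid t0 (p n).1 k by rewrite addr_ge0 ?mulr_ge0// ltW.
  apply: (FM _ gr0); apply: (good_adapted (dif_filtration XD) (dif_brownian XD)
    (dif_adapted XD)) => //.
  - apply: continuous_measurable_fun.
    apply: (continuous_clamp (f := fun x => (1 - e) / g x) (level_le n)).
    move=> x /andP[lx xl].
    have x0 : 0 < x by exact: lt_le_trans (level_gt0 n) lx.
    have xpi : 0 < x < pi.
      by rewrite x0 (le_lt_trans xl)// ltrBlDr ltrDl level_gt0.
    apply: cvgM; first exact: cvg_cst.
    by apply: cvgV; [rewrite gt_eqF// g0|exact: gc].
  - exact: ltW.
  - exact: ltW.
have p0 n : 0 <= (p n).1 by have [/ltW] := Hp n.
have mS n : measurable_fun [set: Omega] (fun w => (S n w)%:E).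
  apply/measurable_EFinP; apply: measurable_sum => k.
  exact: measurable_funM.
have S0 n w : (0 <= (S n w)%:E)%E.
  by rewrite lee_fin sumr_ge0// => k _; rewrite mulr_ge0.
have IS n : (\int[P]_w (S n w)%:E <= (C / (1 + m - 2 * e))%:E)%E.
  have [_ _ _ /(_ t0 (ltW t00))] := Hp n.
  rewrite -lee_fin; apply: le_trans.
  under eq_integral do rewrite -sumEFin.
  rewrite ge0_integral_sum//; last 2 first.
  - by move=> k; apply/measurable_EFinP; apply: measurable_funM.
  - by move=> k w _; rewrite lee_fin mulr_ge0.
  rewrite -sumEFin; apply: lee_sum => k _.
  by rewrite integral_scale_indic// EFinM fineK// fin_num_measure//; exact: mG.
pose W w := limn_einf (fun n => (S n w)%:E).
have W0 w : (0 <= W w)%E by apply: (limn_einf_ge (N := 0%N)) => n _.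
have mW : measurable_fun [set: Omega] W by exact: measurable_limn_einf.
have IW : (\int[P]_w W w <= (C / (1 + m - 2 * e))%:E)%E.
  apply: (@le_trans _ _ (limn_einf (fun n => \int[P]_w (S n w)%:E)%E)).
    exact: fatou.
  exact: limn_einf_le.
apply: (@le_trans _ _ (\int[P]_w (t0%:E + W w))%E); last first.
  have [_ Ec] := has_integral_cst P t0.
  rewrite ge0_integralD//; last by move=> w _; rewrite lee_fin ltW.
  by rewrite Ec leeD2l.
apply: ae_ge0_integral_le.
- exact: hitting_time_ge0.
- by move=> w; rewrite adde_ge0// lee_fin ltW.
- exact: emeasurable_funD.
have := dif_range XD; have := dif_sde XD; have := Xpos.
apply: filterS3 => w Xw0 Xsde Xrange.
(* a path is in the interior of [[0, pi]] on [[t0, r]], hence, by compactness, in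
   [[level n, pi - level n]] for [n] large *)
have key r : t0 < r -> (r%:E < hitting_time X pi w)%E -> ((r - t0)%:E <= W w)%E.
  move=> t0r rt.
  have rin s : s <= r -> (s%:E <= hitting_time X pi w)%E.
    by move=> sr; rewrite (le_trans _ (ltW rt))// lee_fin.
  have Xin s : 0 < s <= r -> 0 < X s w < pi.
    move=> /andP[s0 sr]; have /andP[X0 Xpi] := Xrange s (ltW s0) (rin s sr).
    rewrite !lt_neqAle X0 Xpi !andbT; apply/andP; split.
      by rewrite eq_sym; apply/eqP/(Xw0 s s0 (rin s sr)).
    by apply/eqP; apply: (before_hitting (ltW s0) sr rt).
  have cX s : 0 < s -> {for s, continuous (X ^~ w)}.
    by move=> s0; apply: continuous_paths_at => //; exact: dif_continuous XD.
  have cf s : 0 < s <= r -> {for s, continuous (fun s => (g (X s w))^-1)}.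
    move=> sr; have Xs := Xin s sr; have /andP[s0 _] := sr.
    apply: cvgV; first by rewrite gt_eqF// g0.
    by apply: (continuous_comp (cX s s0)); exact: gc.
  have f0 s : 0 < s <= r -> 0 < (g (X s w))^-1.
    by move=> /Xin Xs; rewrite invr_gt0 g0.
  have sde t : 0 <= t <= r -> ((X t w)%:E = (X 0 w + Num.sqrt 2 * B t w)%:E +
     \int[lebesgue_measure]_(s in `[0%R, t]) ((g (X s w))^-1)%:E)%E.
    by move=> /andP[t0' tr]; apply: Xsde => //; exact: rin.
  have [h0 h0p Hgood] := good_of_path cf f0 sde e0 t00 (ltW t0r).
  have cXr : {within `[t0, r], continuous (X ^~ w)}.
    apply: continuous_in_subspaceT => s /set_mem/= /[!in_itv]/= /andP[t0s _].
    by apply: cX; exact: lt_le_trans t0s.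
  have [c1 c1r Xc1] := EVT_min (ltW t0r) cXr.
  have [c2 c2r Xc2] := EVT_max (ltW t0r) cXr.
  have inr c : c \in `[t0, r] -> 0 < c <= r.
    by rewrite in_itv/= => /andP[t0c ->]; rewrite (lt_le_trans t00).
  have /andP[Xc10 _] := Xin _ (inr _ c1r).
  have /andP[_ Xc2pi] := Xin _ (inr _ c2r).
  pose dl := Num.min (X c1 w) (pi - X c2 w).
  have dl0 : 0 < dl by rewrite lt_min Xc10 subr_gt0.
  have [N1 HN1] := eventually_lt_nat (pi / dl).
  have [N2 HN2] := eventually_lt_nat (h0^-1).
  have [N3 HN3] := eventually_lt_nat (r - t0).
  apply: (limn_einf_ge (N := maxn N1 (maxn N2 N3))) => n.
  rewrite !geq_max => /and3P[/HN1 n1 /HN2 n2 /HN3 n3].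
  have [pn0 pn1 pn2 _] := Hp n.
  have nlev : level n <= dl.
    rewrite /level ler_pdivrMr; last by rewrite ltr_wpDl.
    move: n1; rewrite ltr_pdivrMr// => n1; rewrite mulrDr.
    have : 0 <= dl * 3 by rewrite mulr_ge0// ltW.
    by rewrite (mulrC dl n%:R); lra.
  have pnh : (p n).1 < h0.
    have n10 : 0 < n%:R + 1 :> R by rewrite ltr_wpDl.
    by apply: (lt_trans pn1); rewrite -[ltRHS]invrK ltf_pV2 ?posrE ?invr_gt0//; lra.
  rewrite lee_fin.
  apply: (@le_trans _ _ (Num.min ((p n).1 * (p n).2%:R) (r - t0))).
    by rewrite le_min lexx andbT (le_trans (ltW n3)).
  have := @sum_grid_ge R (p n).1 (r - t0) (fun k => w \in G n k) (p n).2 (p0 n).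
  under eq_bigr do rewrite -indicE.
  apply=> k; rewrite lerBrDl => kr; apply/mem_set.
  apply: Hgood => //; first by rewrite pn0.
  move=> s /andP[t0s sr].
  have sin : s \in `[t0, r] by rewrite in_itv/= t0s.
  have := Xc1 s sin; have := Xc2 s sin; move: nlev; rewrite le_min => /andP[l1 l2] x2 x1.
  by apply/andP; split; lra.
have [//|tW] := leP (hitting_time X pi w) (t0%:E + W w)%E.
exfalso; move: key tW (W0 w); case: (W w) => [v| |] key tW // v0; last first.
  by rewrite ltNge leey in tW.
have v0' : 0 <= v by [].
have [r vr rt] : exists2 r, t0 + v < r & (r%:E < hitting_time X pi w)%E.
  move: tW; case: (hitting_time X pi w) => [u| |] // tW.
    exists ((t0 + v + u) / 2).
      by move: tW; rewrite -EFinD lte_fin; lra.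
    by move: tW; rewrite -EFinD !lte_fin; lra.
  by exists (t0 + v + 1); [rewrite ltrDl|rewrite ltry].
have := key r _ rt; rewrite lee_fin.
have t0r : t0 < r by lra.
by move=> /(_ t0r); lra.
Qed.
End mean_hitting_time.

Unset Implicit Arguments.

Theorem lemma15 (R : realType) (phi : R -> R)
    (phi_ge0 : forall x, x \in `[0, pi] -> 0 <= phi x)
    (phi_C2 : C2_on `[0, pi] phi)
    (phi_incr : {in `[0, pi] &, {homo phi : x y / x < y}})
    (dphi_gt0 : forall x, x \in `]0, pi[ -> 0 < derive_within `[0, pi] phi x)
    (phi_entrance : entrance_boundary_at_0 phi)
    (d : measure_display) (Omega : measurableType d)
    (P : probability Omega R) (F : R -> set (set Omega))
    (B X : R -> Omega -> R)
    (X_diffusion : diffusion P phi 0 F B X)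
    (m : R)
    (m_min : is_min
       (derive_within `[0, pi] (derive_within `[0, pi] phi) @` `[0, pi]) m)
    (m_gt : -1 < m) :
  (\int[P]_w hitting_time X pi w <= ((phi pi - phi 0) / (1 + m))%:E)%E.
Proof.
set C := phi pi - phi 0; set M := 1 + m.
have pi0 := pi_gt0 R.
have M0 : 0 < M by rewrite /M; lra.
have C0 : 0 <= C.
  by rewrite subr_ge0 ltW// phi_incr// ?in_itv/= ?lexx ?ltW.
apply/lee_addgt0Pr => eta eta0.
have eta2 : 0 < eta / 2 by rewrite divr_gt0.
pose Q := C / M + eta / 2.
have Q0 : 0 < Q by rewrite ltr_wpDl// divr_ge0// ltW.
(* chosen so that [C <= Q * (M - 2 * e)] *)
pose e := Num.min (M / 4) (M * (eta / 2) / (2 * Q)).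
have e0 : 0 < e by rewrite lt_min !divr_gt0// ?mulr_gt0.
have eM : e <= M / 4 by rewrite ge_min lexx.
have eQ : e * (2 * Q) <= M * (eta / 2).
  by rewrite -ler_pdivlMr ?mulr_gt0// ge_min lexx orbT.
have kap0 : 0 < 1 + m - 2 * e by rewrite -/M; lra.
have Xpos := phi_entrance.2 _ _ _ _ _ _ X_diffusion.
apply: (le_trans (mean_hitting_time_le phi_ge0 phi_C2 phi_incr dphi_gt0
  X_diffusion Xpos m_min e0 kap0 eta2)).
rewrite -!EFinD lee_fin -/M -/C.
suff : C / (M - 2 * e) <= Q by rewrite /Q; lra.
rewrite ler_pdivrMr//.
have CM : C / M * M = C by rewrite divfK// gt_eqF.
by move: eQ; rewrite /Q; nra.
Qed.
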